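(* Let $f_1,\dots,f_N:\mathcal{X}\to\mathbb{R}$ be such that each $f_i$ is strictly convex, continuously differentiable, and has a minimizer $x_i^*\in\mathcal{X}$. Let $(u(k))_{k=1}^\infty$ be any given sequence of gossiping pairs and let $\mathbf{x}(k)=(\hat{x}_1(k),\dots,\hat{x}_N(k))$, $k\in\mathbb{N}$, be the sequence of estimates generated by Pairwise Equalizing (PE) along $(u(k))_{k=1}^\infty$. Then $(V(\mathbf{x}(k)))_{k=0}^\infty$ is non-increasing and satisfies, for all $k\in\mathbb{P}$, $$V(\mathbf{x}(k))-V(\mathbf{x}(k-1))=-\sum_{i\in u(k)}\Bigl(f_i(\hat{x}_i(k))-f_i(\hat{x}_i(k-1))-f_i'(\hat{x}_i(k-1))\bigl(\hat{x}_i(k)-\hat{x}_i(k-1)\bigr)\Bigr).$$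
   Context: Let $N\ge 2$, $\mathcal{V}=\{1,2,\dots,N\}$, $\mathbb{N}=\{0,1,2,\dots\}$, $\mathbb{P}=\{1,2,\dots\}$, and let $\mathcal{X}\subset\mathbb{R}$ be a nonempty open interval. For each time $k$ the network is an undirected graph $(\mathcal{V},\mathcal{E}(k))$, where $\mathcal{E}(k)\subset\{\{i,j\}:i,j\in\mathcal{V},i\ne j\}$ is nonempty. A sequence of gossiping pairs is a sequence $(u(k))_{k=1}^\infty$ with $u(k)=\{u_1(k),u_2(k)\}\in\mathcal{E}(k)$ a pair of distinct nodes for every $k\in\mathbb{P}$ (the topology is arbitrary and time-varying, so $u(k)$ may be any pair of distinct nodes). Let $F(x)=\sum_{i\in\mathcal{V}}f_i(x)$ for $x\in\mathcal{X}$, and let $x^*$ denote the unique minimizer of $F$ over $\mathcal{X}$ (it exists under the stated assumptions on the $f_i$). Derivatives are denoted $f_i'$. Pairwise Equalizing (PE): the estimates are initialized by $\hat{x}_i(0)=x_i^*$ for all $i\in\mathcal{V}$, and for every $k\in\mathbb{P}$ and $i\in\mathcal{V}$, $$\hat{x}_i(k)=\begin{cases}\bigl(\sum_{j\in u(k)}f_j'\bigr)^{-1}\bigl(\sum_{j\in u(k)}f_j'(\hat{x}_j(k-1))\bigr), & i\in u(k),\\ \hat{x}_i(k-1), & \text{otherwise,}\end{cases}$$ where $(\sum_{j\in u(k)}f_j')^{-1}$ is the inverse of the injective function $\sum_{j\in u(k)}f_j':\mathcal{X}\to\mathbb{R}$ with codomain restricted to its range (the update is always well-defined). The function $V:\mathcal{X}^N\to\mathbb{R}$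 is $$V(x_1,\dots,x_N)=\sum_{i\in\mathcal{V}}\Bigl(f_i(x^* )-f_i(x_i)-f_i'(x_i)(x^*-x_i)\Bigr).$$ *)

(* Defs.v *)
From HB Require Import structures.
From mathcomp Require Import all_boot all_order all_algebra.
From mathcomp Require Import all_classical all_reals all_analysis.

Set Implicit Arguments.
Unset Strict Implicit.
Unset Printing Implicit Defensive.

Import Order.TTheory GRing.Theory Num.Theory.
Import numFieldNormedType.Exports.

Local Open Scope ring_scope.
Local Open Scope classical_set_scope.

(* Functions on an open interval X are total functions R -> R of which only
   the values on X matter; as X is open, so do their derivatives at the points
   of X. *)

Definition strictly_convex_on (R : realType) (X : set R) (f : R -> R) : Prop :=
  forall x y t : R, X x -> X y -> x != y -> 0 < t < 1 ->
    f (t * x + (1 - t) * y) < t * f x + (1 - t) * f y.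

Definition continuously_differentiable_on (R : realType) (X : set R)
    (f : R -> R) : Prop :=
  {in X, forall x, derivable f x 1} /\ {in X, continuous (derive1 f)}.

Definition minimizer_on (R : realType) (X : set R) (f : R -> R) (x : R) : Prop :=
  X x /\ forall y, X y -> f x <= f y.

(* The minimizer of f over X; an arbitrary real if there is none. It is only
   used for strictly convex functions, whose minimizer is unique. *)
Definition argmin_on (R : realType) (X : set R) (f : R -> R) : R :=
  get [set x | minimizer_on X f x].

(* The nodes are the elements of 'I_N and an undirected edge is a set of two
   distinct nodes. Times are numbered from 1: values at 0 are unconstrained
   and unused. *)
Definition time_varying_network (N : nat) (E : nat -> {set {set 'I_N}}) : Prop :=
  forall k, (0 < k)%N ->
    E k != finset.set0 /\ {in E k, forall e : {set 'I_N}, #|e| = 2%N}.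

Definition gossiping_pairs (N : nat) (E : nat -> {set {set 'I_N}})
    (u : nat -> {set 'I_N}) : Prop :=
  forall k, (0 < k)%N -> u k \in E k.

(* [pinv X g] is the inverse on g @` X of the restriction of g to X. *)
Fixpoint pairwise_equalizing (R : realType) (N : nat) (X : set R)
    (f : 'I_N -> R -> R) (u : nat -> {set 'I_N}) (k : nat) : 'I_N -> R :=
  match k with
  | 0%N => fun i => argmin_on X (f i)
  | k'.+1 =>
    let xprev := pairwise_equalizing X f u k' in
    fun i =>
      if i \in u k'.+1 then
        pinv X (fun y => \sum_(j in u k'.+1) derive1 (f j) y)
               (\sum_(j in u k'.+1) derive1 (f j) (xprev j))
      else xprev i
  end.

Definition objective (R : realType) (N : nat) (f : 'I_N -> R -> R) (x : R) : R :=
  \sum_(i < N) f i x.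

Definition lyapunov (R : realType) (N : nat) (X : set R) (f : 'I_N -> R -> R)
    (x : 'I_N -> R) : R :=
  let xstar := argmin_on X (objective f) in
  \sum_(i < N) (f i xstar - f i (x i) - derive1 (f i) (x i) * (xstar - x i)).

(* Main.v *)
Require Import Defs.
From HB Require Import structures.
From mathcomp Require Import all_boot all_order all_algebra.
From mathcomp Require Import all_classical all_reals all_analysis.
From mathcomp Require Import ring lra.

(** Write D_i(z, a) = f_i z - f_i a - f_i' a (z - a) for the Bregman divergence
    of f_i, so that V(x) is the sum over i of D_i(x*, x_i).  Divergences satisfy
    the three-point identity
      D(z, b) - D(z, a) = - D(b, a) + (f' a - f' b) (z - b).
    A gossip step moves all the nodes of u(k) to one common value b, chosen so
    that the derivatives f_i' b and the old derivatives f_i' a_i have the same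
    sum over u(k).  Summing the identity over u(k), the last term becomes
    (sum of (f_i' a_i - f_i' b)) (x* - b) = 0, whatever x* is: this is the
    claimed formula for the decrement of V.  Convexity makes every divergence
    nonnegative ([bregman_ge0]), hence V is non-increasing.

    What has to be checked is that such a b exists in X, so that the inverse
    function in the update is evaluated inside its domain.  The derivatives
    f_i' are nondecreasing on X, so their sum over u(k) is, at the least of the
    old estimates, at most the target value, and at the greatest, at least
    that value; the intermediate value theorem then gives b between them
    ([derive1_sum_equalizer]).  As b stays in X, the argument can be iterated
    ([pairwise_equalizing_in]). *)

Set Implicit Arguments.
Unset Strict Implicit.
Unset Printing Implicit Defensive.

Import Order.TTheory GRing.Theory Num.Theory.
Import numFieldNormedType.Exports.

Local Open Scope ring_scope.
Local Open Scope classical_set_scope.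

Definition bregman (R : realType) (f : R -> R) (z a : R) : R :=
  f z - f a - derive1 f a * (z - a).

Lemma bregman_three_points (R : realType) (f : R -> R) (z a b : R) :
  bregman f z b - bregman f z a =
  - bregman f b a + (derive1 f a - derive1 f b) * (z - b).
Proof. by rewrite /bregman; ring. Qed.

Lemma derive_derive1 (R : realType) (f : R -> R) (x v : R) :
  derivable f x 1 -> derivable f x v /\ 'D_v f x = derive1 f x * v.
Proof.
move=> /derivable1_diffP df; split; first exact: diff_derivable.
rewrite deriveE // derive1E' // mulrC.
by rewrite -[X in 'd f x X](mulr1 v) [LHS]linearZ.
Qed.

(** The chord slopes from a towards z are at most f z - f a by convexity;
    letting the step tend to 0 from the right bounds the derivative of f in the
    direction z - a. *)
Lemma bregman_ge0 (R : realType) (X : set R) (f : R -> R) (z a : R) :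
  strictly_convex_on X f -> X a -> X z -> derivable f a 1 ->
  0 <= bregman f z a.
Proof.
move=> fcvx Xa Xz /(@derive_derive1 _ _ _ (z - a)) [dfa Dfa].
rewrite /bregman -Dfa subr_ge0.
have [->|neq_za] := eqVneq z a; first by rewrite !subrr derive0.
have /cvg_dnbhs_at_right slopes_cvg := dfa.
rewrite /derive (cvg_at_rightE _ _ dfa); apply: limr_le.
  exact: cvgP slopes_cvg.
near=> h.
have h_gt0 : 0 < h by near: h; exact: nbhs_right_gt.
have h_lt1 : h < 1 by near: h; exact: nbhs_right_lt.
rewrite /= -[_ *: _]/(h^-1 * _) ler_pdivrMl //.
have := fcvx z a h Xz Xa neq_za; rewrite h_gt0 h_lt1 => /(_ isT).
have -> : h * z + (1 - h) * a = h *: (z - a) + a.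
  by rewrite -[h *: _]/(h * _); ring.
by move=> /= ?; lra.
Unshelve. all: by end_near. Qed.

(** D(y, x) + D(x, y) = (f' y - f' x) (y - x), a sum of two nonnegative terms. *)
Lemma derive1_nondecreasing_on (R : realType) (X : set R) (f : R -> R) (x y : R) :
  strictly_convex_on X f -> continuously_differentiable_on X f ->
  X x -> X y -> x <= y -> derive1 f x <= derive1 f y.
Proof.
move=> fcvx [fder _] Xx Xy; rewrite le_eqVlt => /predU1P[->//|ltxy].
have Dyx := bregman_ge0 fcvx Xx Xy (fder _ (mem_set Xx)).
have Dxy := bregman_ge0 fcvx Xy Xx (fder _ (mem_set Xy)).
rewrite -subr_ge0 -(pmulr_lge0 _ (_ : 0 < y - x)) ?subr_gt0 //.
by apply: le_trans (addr_ge0 Dyx Dxy) _; rewrite /bregman; lra.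
Qed.

(** Intermediate value theorem between the least and the greatest of the a_i:
    monotonicity of each f_i' puts the target value between the sums at these
    two points. *)
Lemma derive1_sum_equalizer (R : realType) (I : finType) (X : set R)
    (f : I -> R -> R) (A : {set I}) (a : I -> R) :
  is_interval X -> (forall i, strictly_convex_on X (f i)) ->
  (forall i, continuously_differentiable_on X (f i)) ->
  A != finset.set0 -> (forall i, X (a i)) ->
  exists2 b, X b &
    \sum_(j in A) derive1 (f j) b = \sum_(j in A) derive1 (f j) (a j).
Proof.
move=> Xitv fcvx fC1 /finset.set0Pn[i0 Ai0] Xa.
have [imin Amin amin] := arg_minP a Ai0.
have [imax Amax amax] := arg_maxP a Ai0.
have subX : `[a imin, a imax] `<=` X.
  by move=> y /=; rewrite in_itv /=; exact: Xitv.
have le_a : a imin <= a imax by exact: amin.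
have sum_mono x y : X x -> X y -> x <= y ->
    \sum_(j in A) derive1 (f j) x <= \sum_(j in A) derive1 (f j) y.
  move=> Xx Xy lexy; apply: ler_sum => j _.
  exact: derive1_nondecreasing_on (fcvx j) (fC1 j) Xx Xy lexy.
have [|| b b_itv <-] :=
    @IVT R (fun y => \sum_(j in A) derive1 (f j) y) (a imin) (a imax)
      (\sum_(j in A) derive1 (f j) (a j)) le_a; last first.
- by exists b => //; exact: subX.
- rewrite min_l ?max_r ?sum_mono //.
  apply/andP; split; apply: ler_sum => j Aj;
    apply: derive1_nondecreasing_on (fcvx j) (fC1 j) _ _ _ => //.
  + exact: amin.
  + exact: amax.
- apply: continuous_in_subspaceT => y /set_mem /subX Xy.
  apply: cvg_big => [|j _]; first exact: add_continuous.
  exact: (fC1 j).2 (mem_set Xy).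
Qed.

Lemma pinv_in (R : realType) (X : set R) (g : R -> R) (v : R) :
  (g @` X) v -> X (pinv X g v).
Proof.
move=> gXv.
have gX_surj : set_surj X (g @` X) g by [].
by apply: (surjpinv_image_sub gX_surj); exists v.
Qed.

Section PairwiseEqualizing.
Context (R : realType) (N : nat) (X : set R) (f : 'I_N -> R -> R).
Context (u : nat -> {set 'I_N}).
Hypothesis X_itv : is_interval X.
Hypothesis f_sconvex : forall i, strictly_convex_on X (f i).
Hypothesis f_C1 : forall i, continuously_differentiable_on X (f i).
Hypothesis f_min : forall i, exists x, minimizer_on X (f i) x.
Hypothesis u_neq0 : forall k, u k.+1 != finset.set0.

Local Notation x := (pairwise_equalizing X f u).

Lemma pairwise_equalizing_in k i : X (x k i).
Proof.
elim: k i => [|k IHk] i /=; first exact: (getPex (f_min i)).1.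
case: ifP => // _; apply: pinv_in.
have [b Xb fb] := derive1_sum_equalizer X_itv f_sconvex f_C1 (u_neq0 k) IHk.
by exists b.
Qed.

(** Of a gossip step the Lyapunov analysis retains only this: the nodes of
    u(k+1) agree on some b, and the sum of their derivatives is conserved. *)
Lemma pairwise_equalizingS k : exists b,
  (forall i, x k.+1 i = if i \in u k.+1 then b else x k i) /\
  \sum_(j in u k.+1) derive1 (f j) b =
  \sum_(j in u k.+1) derive1 (f j) (x k j).
Proof.
have [b Xb fb] := derive1_sum_equalizer X_itv f_sconvex f_C1 (u_neq0 k)
  (pairwise_equalizing_in k).
pose g y := \sum_(j in u k.+1) derive1 (f j) y.
pose v := \sum_(j in u k.+1) derive1 (f j) (x k j).
exists (pinv X g v); split; first by [].
apply: (@pinvK _ _ (fun=> point) X g v).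
by apply/mem_set; exists b.
Qed.

(** In the sum of the three-point identities over u(k+1), the factor of x* - b
    vanishes by conservation of the derivatives. *)
Lemma lyapunovS k :
  lyapunov X f (x k.+1) - lyapunov X f (x k) =
  - \sum_(i in u k.+1) bregman (f i) (x k.+1 i) (x k i).
Proof.
rewrite /lyapunov; set z := argmin_on _ _.
have [b [xS fb]] := pairwise_equalizingS k.
rewrite -sumrB (bigID (mem (u k.+1))) /= [X in _ + X]big1 ?addr0; last first.
  by move=> i /negbTE ui; rewrite ui subrr.
transitivity (\sum_(i in u k.+1)
    (- bregman (f i) b (x k i)
     + (derive1 (f i) (x k i) - derive1 (f i) b) * (z - b))).
  apply: eq_bigr => i ui; rewrite -bregman_three_points.
  by have := xS i; rewrite /= ui => ->.
rewrite big_split /= -mulr_suml sumrB fb subrr mul0r addr0 sumrN.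
by congr (- _); apply: eq_bigr => i ui; have := xS i; rewrite /= ui => ->.
Qed.

End PairwiseEqualizing.

Theorem lemma2 (R : realType) (N : nat) (hN : (2 <= N)%N)
  (X : set R) (X_open : open X) (X_itv : is_interval X) (X_neq0 : X !=set0)
  (E : nat -> {set {set 'I_N}}) (hE : time_varying_network E)
  (f : 'I_N -> R -> R)
  (f_sconvex : forall i, strictly_convex_on X (f i))
  (f_C1 : forall i, continuously_differentiable_on X (f i))
  (f_min : forall i, exists x, minimizer_on X (f i) x)
  (u : nat -> {set 'I_N}) (hu : gossiping_pairs E u) :
  let x := pairwise_equalizing X f u in
  nonincreasing_seq (fun k => lyapunov X f (x k)) /\
  (forall k, (0 < k)%N ->
    lyapunov X f (x k) - lyapunov X f (x k.-1) =
    - \sum_(i in u k)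
        (f i (x k i) - f i (x k.-1 i)
         - derive1 (f i) (x k.-1 i) * (x k i - x k.-1 i))).
Proof.
move=> x.
have u_neq0 k : u k.+1 != finset.set0.
  by rewrite -card_gt0 ((hE k.+1 isT).2 _ (hu k.+1 isT)).
split; last first.
  by case=> // k _; exact: lyapunovS.
apply/nonincreasing_seqP => k; rewrite -subr_le0 lyapunovS // oppr_le0.
have xX := pairwise_equalizing_in X_itv f_sconvex f_C1 f_min u_neq0.
apply: sumr_ge0 => i _.
exact: bregman_ge0 (f_sconvex i) (xX k i) (xX k.+1 i)
  ((f_C1 i).1 _ (mem_set (xX k i))).
Qed.
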